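(* Assume that for some $c>3$ and $\epsilon>0$ one has $$\frac{c}{n}<p<n^{-1/2-\epsilon}.$$ Let $Y'$ be the random 2-complex obtained from a random 2-complex $Y\in Y(n,p)$ by the following face-removal procedure: one finds all subcomplexes of $Y$ isomorphic to members of $\mathcal A_\epsilon$ and removes from each of them one face $\sigma$ (chosen randomly or by a certain rule) such that $\partial\sigma$ is null-homotopic in the complement of the interior of $\sigma$ in that subcomplex. Then, asymptotically almost surely, the second Betti number of $Y'$ satisfies $$n^2\cdot\frac{c-3}{8}\ \le\ b_2(Y')\ \le\ n^{5/2-\epsilon}.$$
   Context: $Y(n,p)$ is the Linial–Meshulam model: a random 2-complex $Y\in Y(n,p)$ is a simplicial complex on the vertex set $\{1,\dots,n\}$ which contains the complete 1-skeleton (all vertices and all edges) of the simplex on $\{1,\dots,n\}$ and in which each of the $\binom n3$ triangles is included independently with probability $p=p(n)$. ''Asymptotically almost surely'' means with probability tending to $1$ as $n\to\infty$. A 2-complex is a finite simplicial complex of dimension $\le 2$; its 2-simplexes are called faces; it is pure if every vertex and every edge is incident to a face. A finite pure 2-complex $Z$ is a minimal cycle if $b_2(Z)=1$ and $b_2(Z')=0$ for every proper subcomplex $Z'\subset Z$. $\mu(Z)=v(Z)/f(Z)$ is the ratio of the numbers of vertices and faces of $Z$. $\mathcal A_\epsilon$ denotes the finite set of all isomorphism types of minimal cycles $Z$ having at most $2\epsilon^{-1}$ faces and satisfying $\mu(Z)>1/2$. Every minimal cycle $Z$ with $\mu(Z)>1/2$ has a face $\sigma$ such that the curve $\partial\sigma$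 is null-homotopic in $Z-\mathrm{Int}(\sigma)$, so the face required by the procedure exists. Removing a face means deleting its interior. *)

(* Defs.v *)
From HB Require Import structures.
From mathcomp Require Import all_boot all_order all_algebra.
From mathcomp Require Import all_classical all_reals all_analysis.

Set Implicit Arguments.
Unset Strict Implicit.
Unset Printing Implicit Defensive.

Import Order.TTheory GRing.Theory Num.Theory.
Import numFieldNormedType.Exports.

Local Open Scope ring_scope.

(* A finite simplicial complex with vertices in {0, ..., n-1} is the finite
   set of its nonempty simplices, each one given by its set of vertices.
   Not every i : 'I_n has to be a vertex. *)
Definition is_complex n (K : {set {set 'I_n}}) : Prop :=
  finset.set0 \notin K /\
  forall s t : {set 'I_n}, s \in K -> t \subset s -> t != finset.set0 -> t \in K.

Definition simplices n (K : {set {set 'I_n}}) (k : nat) : {set {set 'I_n}} :=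
  [set s in K | #|s| == k.+1].

Definition is_2complex n (K : {set {set 'I_n}}) : Prop :=
  is_complex K /\ forall s, s \in K -> (#|s| <= 3)%N.

Definition vertices n (K : {set {set 'I_n}}) : {set 'I_n} :=
  [set i | [set i] \in K].

Definition faces n (K : {set {set 'I_n}}) : {set {set 'I_n}} := simplices K 2.

Definition pure_2complex n (K : {set {set 'I_n}}) : Prop :=
  is_2complex K /\
  forall s, s \in K -> exists2 t, t \in faces K & s \subset t.

(* Simplices are oriented by the order of 'I_n: the vertex x of s contributes
   s :\ x with sign (-1)^i, i being the number of vertices of s below x. *)
Definition incidence n (s t : {set 'I_n}) : rat :=
  \sum_(x in s | s :\ x == t) (-1) ^+ #|[set y in s | (y < x)%N]|.

(* The map C_k -> C_(k-1) acts on row vectors. For k = 0, where k.-1 = 0,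
   all the entries are 0. *)
Definition boundary n (K : {set {set 'I_n}}) (k : nat) :
    'M[rat]_(#|simplices K k|, #|simplices K k.-1|) :=
  \matrix_(i, j) incidence (enum_val i) (enum_val j).

(* dim H_k(K; Q) = dim Z_k - dim B_k; the subtraction does not truncate since
   B_k is contained in Z_k. *)
Definition betti n (K : {set {set 'I_n}}) (k : nat) : nat :=
  (\rank (kermx (boundary K k)) - \rank (boundary K k.+1))%N.

Definition minimal_cycle n (Z : {set {set 'I_n}}) : Prop :=
  [/\ pure_2complex Z, betti Z 2 = 1%N &
      forall Z' : {set {set 'I_n}},
        is_complex Z' -> Z' \proper Z -> betti Z' 2 = 0%N].

Definition mu n (Z : {set {set 'I_n}}) : rat :=
  #|vertices Z|%:R / #|faces Z|%:R.

(* Representatives of the isomorphism types in A_eps, on all vertex sets. *)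
Definition in_A (R : realType) (eps : R) m (Z : {set {set 'I_m}}) : Prop :=
  [/\ minimal_cycle Z, (#|faces Z|%:R : R) <= 2 * eps^-1 & 1 / 2 < mu Z].

(* f only matters on the vertices of K. Being total, it does not exist when
   0 < m and n = 0, that is, only when L has no vertices. *)
Definition isomorphic m n (K : {set {set 'I_m}}) (L : {set {set 'I_n}}) :
    Prop :=
  exists f : 'I_m -> 'I_n,
    {in vertices K &, injective f} /\ L = [set f @: s | s : {set 'I_m} in K].

Definition A_subcomplex (R : realType) (eps : R) n (Y S : {set {set 'I_n}}) :
    Prop :=
  [/\ is_complex S, S \subset Y &
      exists m (Z : {set {set 'I_m}}), in_A eps Z /\ isomorphic Z S].

(* Geometric realization, in barycentric coordinates. *)
Definition realization (R : realType) n (K : {set {set 'I_n}}) :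
    set 'rV[R]_n :=
  [set x | [/\ forall i, 0 <= x 0 i, \sum_i x 0 i = 1 &
               [set i | x 0 i != 0]%SET \in K]]%classic.
Arguments realization R {n} K _.

Definition boundary_complex n (s : {set 'I_n}) : {set {set 'I_n}} :=
  [set t : {set 'I_n} | (t != finset.set0) && (t \proper s)].

(* The inclusion of A in X is homotopic in X to a constant map. *)
Definition null_homotopic_in (R : realType) n (A X : set 'rV[R]_n) : Prop :=
  exists (H : R * 'rV[R]_n -> 'rV[R]_n) (x0 : 'rV[R]_n),
    [/\ {within `[0, 1] `*` A, continuous H}%classic,
        forall u x, 0 <= u <= 1 -> A x -> X (H (u, x)),
        forall x, A x -> H (0, x) = x &
        forall x, A x -> H (1, x) = x0].

(* S :\ s is S with the interior of the face s deleted. *)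
Definition removable_face (R : realType) n (S : {set {set 'I_n}})
    (s : {set 'I_n}) : Prop :=
  s \in faces S /\
  null_homotopic_in (realization R (boundary_complex s)) (realization R (S :\ s)).

(* All the subcomplexes are found in Y itself, before any removal; the faces
   sel S chosen in different subcomplexes S may coincide. *)
Definition face_removal (R : realType) (eps : R) n (Y Y' : {set {set 'I_n}}) :
    Prop :=
  exists sel : {set {set 'I_n}} -> {set 'I_n},
    (forall S, A_subcomplex eps Y S -> removable_face R S (sel S)) /\
    (forall t, t \in Y' <->
       t \in Y /\ ~ exists2 S, A_subcomplex eps Y S & sel S = t).

Definition random_complex (d : measure_display) (Omega : measurableType d) n
    (Y : Omega -> {set {set 'I_n}}) : Prop :=
  forall K, measurable [set w | Y w = K]%classic.

Definition mutually_independent (R : realType) (d : measure_display)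
    (Omega : measurableType d) (P : probability Omega R) (I : finType)
    (J : {set I}) (E : I -> set Omega) : Prop :=
  forall B : {set I}, B \subset J ->
    P [set w | forall i, i \in B -> E i w]%classic =
    (\prod_(i in B) P (E i))%E.

(* Y has law Y(n, p). *)
Definition linial_meshulam (R : realType) (d : measure_display)
    (Omega : measurableType d) (P : probability Omega R) n (p : R)
    (Y : Omega -> {set {set 'I_n}}) : Prop :=
  let triangles := [set t : {set 'I_n} | #|t| == 3%N] in
  let present (t : {set 'I_n}) := [set w | t \in Y w]%classic in
  [/\ random_complex Y,
      forall w, is_2complex (Y w),
      forall w (s : {set 'I_n}), (1 <= #|s| <= 2)%N -> s \in Y w,
      forall t, t \in triangles -> P (present t) = p%:E &
      mutually_independent P triangles present].

(* Main.v *)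
Require Import Defs.
From HB Require Import structures.
From mathcomp Require Import all_boot all_order all_algebra.
From mathcomp Require Import all_classical all_reals all_analysis.
From mathcomp Require Import zify ring lra.
Import Order.TTheory GRing.Theory Num.Theory.
Import numFieldNormedType.Exports.
Local Open Scope ring_scope.

(** A minimal cycle [Z] with [v] vertices and [f] faces satisfies
    [v <= f / 2 + 2]: the equations [rank d_1 = v - 1] and [rank d_2 = f - 1]
    together with [d_1 d_2 = 0] give [(v - 1) + (f - 1) <= e], and [2 e <= 3 f]
    since every edge lies in at least two faces. Since [p < n^(-1/2 - eps)], the
    expected number of copies of [Z] in [Y] is at most of order
    [n^v p^f <= n^(2 - eps f) = o(n^2)], so a.a.s. [o(n^2)] faces are removed. By
    Chebyshev's inequality [Y] has about [p n^3 / 6] faces, that is, at least about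
    [c n^2 / 6] and at most [n^(5/2 - eps)] of them. The result follows from
    [f(Y') - n^2 / 2 <= b_2(Y') <= f(Y')]. *)

(** * Minimal cycles *)

Lemma incidence_neq0_sub n (s t : {set 'I_n}) : incidence s t != 0 -> t \subset s.
Proof.
apply: contra_neqT => tNs; rewrite /incidence big_pred0// => x.
apply/negP => /andP[_ /eqP st]; move/negP: tNs; apply.
by rewrite -st subsetDl.
Qed.

Lemma incidence_facet n (s : {set 'I_n}) x :
  x \in s -> incidence s (s :\ x) = (-1) ^+ #|[set y in s | (y < x)%N]|.
Proof.
move=> xs; rewrite /incidence (big_pred1 x)// => y /=.
apply/andP/eqP => [[ys /eqP/setP/(_ y)]|->//].
by rewrite !inE eqxx ys /= andbT => /esym/negbFE/eqP.
Qed.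

(** [incidence s t] vanishes unless [t] is a facet of [s], so the sum over [A] can be reindexed by
    the deleted vertex. *)
Lemma sum_incidence n (A : {set {set 'I_n}}) (g : {set 'I_n} -> rat)
    (s : {set 'I_n}) : (forall x, x \in s -> s :\ x \in A) ->
  \sum_(t in A) g t * incidence s t =
  \sum_(x in s) g (s :\ x) * (-1) ^+ #|[set y in s | (y < x)%N]|.
Proof.
move=> sA; under eq_bigr => t _ do rewrite /incidence big_distrr /=.
rewrite (exchange_big_dep (mem s)) /=; last by move=> ? ? _ /andP[].
apply: eq_bigr => x xs.
rewrite (big_pred1 (s :\ x))// => t /=.
rewrite xs /= eq_sym andb_idl// => /eqP ->.
exact: sA.
Qed.

(** Deleting [x] lowers the number of vertices of [s] below [y] by one exactly when [x < y]. *)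
Lemma sgn_facet n (s : {set 'I_n}) x y : x \in s -> y \in s -> x != y ->
  (-1) ^+ #|[set z in s :\ x | (z < y)%N]| =
  (-1) ^+ (x < y)%N * (-1) ^+ #|[set z in s | (z < y)%N]| :> rat.
Proof.
move=> xs ys xy.
rewrite -[in RHS](finset.setD1K xs) [in RHS](cardsD1 x).
have -> : [set z in x |: s :\ x | (z < y)%N] :\ x = [set z in s :\ x | (z < y)%N].
  by apply/setP => z; rewrite !inE; case: eqP.
by rewrite !inE eqxx /= exprD signrMK.
Qed.

(** This is one matrix entry of the identity that the boundary of a boundary is zero. Only the
    facets of [s] contribute, so [A] may be any family containing them. *)
Lemma incidence_incidence n (A : {set {set 'I_n}}) (s v : {set 'I_n}) :
  (forall x, x \in s -> s :\ x \in A) ->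
  \sum_(t in A) incidence s t * incidence t v = 0.
Proof.
move=> sA; under eq_bigr do rewrite mulrC.
rewrite sum_incidence//.
pose S x := (-1) ^+ #|[set z in s | (z < x)%N]| : rat.
pose Q (x y : 'I_n) := [&& x \in s, y \in s, x != y & s :\ x :\ y == v].
pose G (x y : 'I_n) := (-1) ^+ (x < y)%N * S y * S x.
have -> : \sum_(x in s) incidence (s :\ x) v * S x =
          \sum_x \sum_(y | Q x y) G x y.
  rewrite [RHS](bigID (fun x => x \in s)) /= [X in _ = _ + X]big1 ?addr0; last first.
    by move=> x xs; apply: big1 => y; rewrite /Q (negPf xs).
  apply: eq_bigr => x xs.
  rewrite /incidence big_distrl /=; apply: eq_big => y.
    by rewrite /Q xs !inE eq_sym /= !andbA [(_ != _) && _]andbC.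
  by rewrite !inE => /andP[/andP[yx ys] _]; rewrite sgn_facet// eq_sym.
(* The terms indexed by (x, y) and (y, x) are opposite. *)
set T := LHS; suff : T = - T.
  by move/eqP; rewrite -addr_eq0 -mulr2n mulrn_eq0 /= => /eqP.
rewrite {1}/T (exchange_big_dep xpredT)//= /T -sumrN.
apply: eq_bigr => y _; rewrite -sumrN; apply: eq_big => x.
  rewrite /Q eq_sym andbCA; congr [&& _, _, _ & _].
  by rewrite !finset.setDDl finset.setUC.
move=> /and4P[_ _ xy _]; rewrite /G -!mulNr mulrAC; congr (_ * _ * _).
by have := xy; rewrite neq_ltn => /orP[] h; rewrite h ltnNge (ltnW h) ?expr0 ?expr1 ?opprK.
Qed.

(** Chains are given by functions on all sets of vertices, so the same [g] restricts to a subcomplex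
    without reindexing rows. *)
Definition chain_row {n} (K : {set {set 'I_n}}) k (g : {set 'I_n} -> rat) :
  'rV[rat]_#|simplices K k| := \row_i g (enum_val i).

Lemma chain_row_ex n (K : {set {set 'I_n}}) k (u : 'rV[rat]_#|simplices K k|) :
  exists g, u = chain_row K k g.
Proof.
(* By injectivity of [enum_val] this sum has at most one term; it is 0 outside the [k]-simplices. *)
exists (fun s => \sum_(i | enum_val i == s) u 0 i).
apply/rowP => i; rewrite mxE (big_pred1 i)// => j.
by rewrite (inj_eq enum_val_inj).
Qed.

Definition is_cycle2 {n} (K : {set {set 'I_n}}) (g : {set 'I_n} -> rat) :=
  forall t, t \in simplices K 1 -> \sum_(s in faces K) g s * incidence s t = 0.

Lemma is_cycle2P n (K : {set {set 'I_n}}) g :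
  is_cycle2 K g <-> (chain_row K 2 g <= kermx (boundary K 2))%MS.
Proof.
have E j : (chain_row K 2 g *m boundary K 2) 0 j =
    \sum_(s in faces K) g s * incidence s (enum_val j).
  by rewrite mxE [RHS]big_enum_val; apply: eq_bigr => i _; rewrite !mxE.
split=> [gK|/sub_kermxP gK t tK].
  by apply/sub_kermxP/rowP => j; rewrite E mxE gK// enum_valP.
have := E (enum_rank_in tK t).
by rewrite gK mxE enum_rankK_in.
Qed.

(** Without 3-simplices, the matrix [boundary K 3] has no rows. *)
Lemma betti2E n (K : {set {set 'I_n}}) : (forall s, s \in K -> #|s| <= 3)%N ->
  betti K 2 = \rank (kermx (boundary K 2)).
Proof.
move=> K3; rewrite /betti [X in (_ - X)%N](_ : _ = 0%N) ?subn0//.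
apply/eqP; rewrite -leqn0 (leq_trans (rank_leq_row _))// leqn0 cards_eq0.
apply/eqP/setP => s; rewrite !inE; apply/negP => /andP[/K3 + /eqP sE].
by rewrite sE.
Qed.

Lemma betti2_eq0 n (K : {set {set 'I_n}}) g : (forall s, s \in K -> #|s| <= 3)%N ->
  betti K 2 = 0%N -> is_cycle2 K g -> forall s, s \in faces K -> g s = 0.
Proof.
move=> K3 + /is_cycle2P gK s sK; rewrite betti2E// => /eqP.
rewrite mxrank_eq0 => /eqP k0; move: gK; rewrite k0 submx0 => /eqP/rowP.
by move=> /(_ (enum_rank_in sK s)); rewrite !mxE enum_rankK_in.
Qed.

Lemma betti2_eq1 n (K : {set {set 'I_n}}) : (forall s, s \in K -> #|s| <= 3)%N ->
  betti K 2 = 1%N ->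
  exists z, [/\ is_cycle2 K z, exists2 s, s \in faces K & z s != 0 &
    forall g, is_cycle2 K g -> exists a, forall s, s \in faces K -> g s = a * z s].
Proof.
move=> K3; rewrite betti2E// => r1.
have /rowV0Pn[u uK u0] : kermx (boundary K 2) != 0 by rewrite -mxrank_eq0 r1.
have [z zE] := chain_row_ex _ _ _ u; subst u.
exists z; split; first exact/is_cycle2P.
- move/rV0Pn: u0 => [i]; rewrite mxE => zi.
  by exists (enum_val i) => //; exact: enum_valP.
- move=> g /is_cycle2P gK.
  have : (kermx (boundary K 2) <= chain_row K 2 z)%MS.
    have [_ <-] := mxrank_leqif_sup uK.
    by rewrite r1 rank_rV u0.
  move=> /(submx_trans gK)/sub_rVP[a /rowP gE]; exists a => s sK.
  by have := gE (enum_rank_in sK s); rewrite !mxE enum_rankK_in.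
Qed.

Lemma facet_complex n (K : {set {set 'I_n}}) s x : is_complex K ->
  s \in K -> (1 < #|s|)%N -> x \in s -> s :\ x \in K.
Proof.
move=> [_ Kd] sK s1 xs; apply: (Kd s) => //; first exact: subsetDl.
by move: s1; rewrite (cardsD1 x) xs add1n ltnS card_gt0.
Qed.

Lemma facet_simplices n (K : {set {set 'I_n}}) k s x : is_complex K ->
  s \in simplices K k.+1 -> x \in s -> s :\ x \in simplices K k.
Proof.
move=> cK; rewrite !inE => /andP[sK /eqP s1] xs; rewrite facet_complex ?s1//=.
by move: s1; rewrite (cardsD1 x) xs add1n => -[->].
Qed.

(** If [z] vanished on a face [s], it would still be a cycle of the proper subcomplex [Z :\ s],
    whose second Betti number is 0, so [z] would vanish on every face. *)
Lemma minimal_cycle_full_support n (Z : {set {set 'I_n}}) z : minimal_cycle Z ->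
  is_cycle2 Z z -> (exists2 s, s \in faces Z & z s != 0) ->
  forall s, s \in faces Z -> z s != 0.
Proof.
move=> [[[[Z0 Zd] Z3] _] _ Zmin] zZ [s0 s0Z zs0] s sZ.
apply: contra_neq zs0 => zs.
have sZ' : s \in Z by move: sZ; rewrite inE => /andP[].
have s3 : #|s| = 3 by move: sZ; rewrite inE => /andP[_ /eqP].
have [->//|s0s] := eqVneq s0 s.
apply: (betti2_eq0 _ (Z :\ s) z).
- by move=> t; rewrite inE => /andP[_ /Z3].
- apply: Zmin; last exact: finset.properD1.
  (* [Z :\ s] is closed under taking simplices of simplices because [s], having three vertices, is
     maximal in [Z]. *)
  split; first by rewrite inE negb_and Z0 orbT.
  move=> t u; rewrite !inE => /andP[ts tZ] ut u0; rewrite (Zd t)// andbT.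
  apply: contra_neq ts => us; apply/eqP; rewrite eq_sym eqEcard -us ut /=.
  by rewrite us s3 Z3.
- move=> t; rewrite !inE => /andP[/andP[ts tZ] t2].
  rewrite -[RHS](zZ t) ?inE ?tZ//.
  rewrite [RHS](bigD1 s)//= zs mul0r add0r; apply: eq_bigl => r.
  by rewrite !inE -andbA andbC.
- by move: s0Z; rewrite !inE s0s.
Qed.

(** Purity gives one face [s] containing [t]. Were it the only one, the cycle equation at [t] would
    reduce to [z s] times a sign being 0, against full support. *)
Lemma minimal_cycle_edge_degree n (Z : {set {set 'I_n}}) t : minimal_cycle Z ->
  t \in simplices Z 1 -> (1 < #|[set s in faces Z | t \subset s]|)%N.
Proof.
move=> mZ tZ; have [[[cZ Z3] Zp] b1 _] := mZ.
have [z [zZ z0 _]] := betti2_eq1 _ _ Z3 b1.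
have [tK /eqP t2] : t \in Z /\ #|t| == 2%N by move: tZ; rewrite inE => /andP.
have [s sZ ts] := Zp _ tK.
rewrite ltnNge; apply/negP => deg1.
have s3 : #|s| = 3 by move: sZ; rewrite inE => /andP[_ /eqP].
have := zZ _ tZ; rewrite (bigD1 s)//= big1 ?addr0; last first.
  move=> r /andP[rZ rs]; apply/eqP; rewrite mulf_eq0; apply/orP; right.
  apply: contraNT rs => /incidence_neq0_sub tr.
  have deg u : (u \in [set s in faces Z | t \subset s]) = (u \in faces Z) && (t \subset u).
    by rewrite inE.
  have /card_le1P/(_ s) := deg1; rewrite deg sZ ts => /(_ isT r).
  by rewrite deg rZ tr inE => <-.
apply/eqP; rewrite mulf_neq0 ?(minimal_cycle_full_support _ _ _ mZ zZ z0)//.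
have : #|s :\: t| == 1%N by rewrite cardsD (finset.setIidPr ts) s3 t2.
move=> /cards1P[x sx].
have xs : x \in s by have := set11 x; rewrite -sx inE => /andP[].
have -> : t = s :\ x by rewrite -sx finset.setDDr finset.setDv finset.set0U (finset.setIidPr ts).
by rewrite incidence_facet// signr_eq0.
Qed.

(** Double counting of pairs of an edge and a face containing it: at least two faces per edge, at
    most three edges per face. *)
Lemma minimal_cycle_edges n (Z : {set {set 'I_n}}) : minimal_cycle Z ->
  (2 * #|simplices Z 1| <= 3 * #|faces Z|)%N.
Proof.
move=> mZ.
apply: (@leq_trans (\sum_(t in simplices Z 1) #|[set s in faces Z | t \subset s]|)).
  rewrite mulnC -sum_nat_const; apply: leq_sum => t tZ.
  exact: minimal_cycle_edge_degree.
under eq_bigr do rewrite -sum1dep_card big_mkcondr /=.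
rewrite exchange_big /= mulnC -sum_nat_const; apply: leq_sum => s.
rewrite inE => /andP[_ /eqP s3].
rewrite -big_mkcondr sum1dep_card.
apply: (@leq_trans #|[set t : {set 'I_n} | t \subset s & #|t| == 2%N]|).
  by apply/subset_leq_card/fintype.subsetP => t; rewrite !inE => /andP[/andP[_ ->] ->].
by rewrite cards_draws s3.
Qed.

(* If z spans the 2-cycles and g is locally constant, then g z is a 2-cycle, hence a
   multiple of z; as z does not vanish on any face, g is constant. *)
Lemma minimal_cycle_connected n (Z : {set {set 'I_n}}) (g : {set 'I_n} -> rat) :
  minimal_cycle Z ->
  (forall t, t \in simplices Z 1 -> \sum_(v in simplices Z 0) g v * incidence t v = 0) ->
  exists a, forall v, v \in simplices Z 0 -> g v = a.
Proof.
move=> mZ gZ; have [[[cZ Z3] Zp] b1 _] := mZ.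
have [z [zZ z0 zu]] := betti2_eq1 _ _ Z3 b1.
have gE s x y : s \in Z -> x \in s -> y \in s -> (x < y)%N -> g [set x] = g [set y].
  move=> sZ xs ys xy.
  have xNy : x != y by rewrite neq_ltn xy.
  have tZ : [set x; y] \in simplices Z 1.
    rewrite inE cards2 xNy eqxx andbT; have [_ Zd] := cZ; apply: (Zd s) => //.
      by rewrite finset.subUset !finset.sub1set xs.
    by apply/finset.set0Pn; exists x; rewrite !inE eqxx.
  (* At the edge with vertices [x < y] the hypothesis on [g] reads [g [set y] - g [set x] = 0]. *)
  have := gZ _ tZ; rewrite sum_incidence; last by move=> u; exact: facet_simplices.
  rewrite finset.big_setU1 ?inE//= big_set1.
  have -> : [set x; y] :\ x = [set y].
    by apply/setP => u; rewrite !inE; case: eqVneq => // ->; rewrite (negPf xNy).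
  have -> : [set x; y] :\ y = [set x].
    apply/setP => u; rewrite !inE; case: (u =P y) => [->|]; last by rewrite orbF.
    by rewrite eq_sym (negPf xNy).
  rewrite (_ : [set u in [set x; y] | (u < x)%N] = finset.set0); last first.
    apply/setP => u; rewrite !inE; apply/negP => /andP[/orP[] /eqP ->].
      by rewrite ltnn.
    by rewrite ltnNge ltnW.
  rewrite (_ : [set u in [set x; y] | (u < y)%N] = [set x]); last first.
    apply/setP => u; rewrite !inE; case: (eqVneq u x) => [->//|ux] /=.
    by case: (eqVneq u y) => [->|//]; rewrite ltnn.
  by rewrite cards0 cards1 expr0 expr1 mulr1 mulrN1 => /subr0_eq.
have gc s x y : s \in Z -> x \in s -> y \in s -> g [set x] = g [set y].
  move=> sZ xs ys; have [xy|yx|/val_inj -> //] := ltngtP x y.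
    exact: (gE s).
  by apply/esym; exact: (gE s).
(* [W] extends [g] to all simplices by its common value at the vertices; the default 0 concerns only
   the empty set. *)
pose W (s : {set 'I_n}) := if [pick x in s] is Some x then g [set x] else 0.
have WE s x : s \in Z -> x \in s -> W s = g [set x].
  move=> sZ xs; rewrite /W; case: pickP => [y ys|/(_ x)]; first exact: (gc s).
  by rewrite xs.
have zW : is_cycle2 Z (fun s => W s * z s).
  (* Every face [s] through the edge [t] shares a vertex with it, so [W s = W t] factors out of the
     cycle equation of [z]. *)
  move=> t tZ; transitivity (W t * \sum_(s in faces Z) z s * incidence s t); last first.
    by rewrite zZ ?mulr0.
  rewrite big_distrr /=.
  apply: eq_bigr => s sZ; rewrite -mulrA.
  have [->|/incidence_neq0_sub ts] := eqVneq (incidence s t) 0; first by rewrite !mulr0.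
  congr (_ * _); move: sZ tZ; rewrite !inE => /andP[sZ _] /andP[tZ /eqP t2].
  have /card_gt0P[x xt] : (0 < #|t|)%N by rewrite t2.
  by rewrite (WE s x)// ?(WE t x)//; exact: (fintype.subsetP ts).
have [a aE] := zu _ zW; exists a => v; rewrite inE => /andP[vZ /cards1P[x vx]].
have [s sZ vs] := Zp _ vZ.
have /mulIf zs0 := minimal_cycle_full_support _ _ _ mZ zZ z0 _ sZ.
have <- := zs0 _ _ (aE _ sZ).
rewrite vx (WE s x)//; first by move: sZ; rewrite inE => /andP[].
by apply: (fintype.subsetP vs); rewrite vx set11.
Qed.

Lemma card_vertices n (K : {set {set 'I_n}}) : #|vertices K| = #|simplices K 0|.
Proof.
rewrite -(card_imset _ (@set1_inj 'I_n)); congr #|pred_of_set _|.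
apply/setP => s; rewrite inE; apply/imsetP/andP.
  by move=> [x + ->]; rewrite inE cards1.
by move=> [sK /cards1P[x sx]]; exists x => //; rewrite inE -sx.
Qed.

Lemma minimal_cycle_faces_gt0 n (Z : {set {set 'I_n}}) :
  minimal_cycle Z -> (0 < #|faces Z|)%N.
Proof.
move=> [[[_ Z3] _] + _]; rewrite betti2E// => b1.
by have := rank_leq_row (kermx (boundary Z 2)); rewrite b1.
Qed.

Lemma minimal_cycle_vertices n (Z : {set {set 'I_n}}) :
  minimal_cycle Z -> (2 * #|vertices Z| <= #|faces Z| + 4)%N.
Proof.
move=> mZ; have [[[cZ Z3] Zp] b1 _] := mZ.
have f0 := minimal_cycle_faces_gt0 _ _ mZ.
have eE := minimal_cycle_edges _ _ mZ.
have r2 : (\rank (boundary Z 2) + 1 = #|faces Z|)%N.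
  have := b1; rewrite betti2E// mxrank_ker; move: f0; rewrite /faces; lia.
have d0 : boundary Z 2 *m boundary Z 1 = 0.
  apply/matrixP => i j; rewrite !mxE.
  rewrite -[RHS](incidence_incidence n (simplices Z 1) (enum_val i) (enum_val j)).
    by rewrite [RHS]big_enum_val; apply: eq_bigr => k _; rewrite !mxE.
  by move=> x; apply: facet_simplices => //; exact: enum_valP.
(* The kernel of the transpose of [boundary Z 1] consists of the locally constant functions on
   vertices. These are constant by connectedness, so it has dimension at most 1. *)
have r1 : (#|vertices Z| <= \rank (boundary Z 1) + 1)%N.
  rewrite card_vertices -leq_subLR -[X in (_ - X)%N]mxrank_tr -mxrank_ker.
  suff : (kermx (boundary Z 1)^T <= (const_mx 1 : 'rV_ _))%MS.
    by move=> /mxrankS /leq_trans; apply; exact: rank_leq_row.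
  apply/rV_subP => u; have [g -> /sub_kermxP ug] := chain_row_ex _ _ _ u.
  have [|a aE] := minimal_cycle_connected _ _ g mZ.
    move=> t tZ; have /rowP/(_ (enum_rank_in tZ t)) := ug; rewrite !mxE; apply: etrans.
    rewrite [LHS]big_enum_val; apply: eq_bigr => k _.
    by rewrite !mxE enum_rankK_in.
  apply/sub_rVP; exists a; apply/rowP => i; rewrite !mxE mulr1 aE//.
  exact: enum_valP.
have re : (\rank (boundary Z 2) + \rank (boundary Z 1) <= #|simplices Z 1|)%N.
  exact: mulmx0_rank_max d0.
by move: r1 r2 eE re; lia.
Qed.

(** * Face sets of small minimal cycles *)

Definition triangles n : {set {set 'I_n}} := [set t : {set 'I_n} | #|t| == 3%N].

(* A superset of the face sets of the copies of members of A_eps, if M >= 2 / eps; the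
   last condition is v <= f / 2 + 2. *)
Definition sparse {n} M (T : {set {set 'I_n}}) :=
  [&& T \subset triangles n, (0 < #|T| <= M)%N & (2 * #|finset.cover T| <= #|T| + 4)%N].

Lemma isomorphic_faces m n (K : {set {set 'I_m}}) (L : {set {set 'I_n}}) :
  is_complex K -> isomorphic K L ->
  #|faces L| = #|faces K| /\ (#|finset.cover (faces L)| <= #|vertices K|)%N.
Proof.
move=> [K0 Kd] [f [f_inj ->]].
have sV s : s \in K -> s \subset vertices K.
  move=> sK; apply/fintype.subsetP => x xs; rewrite inE (Kd s)// ?sub1set//.
    by rewrite finset.sub1set.
  by apply/finset.set0Pn; exists x; rewrite inE.
have cf s : s \in K -> #|f @: s| = #|s|.
  move=> sK; apply: card_in_imset => x y xs ys.
  by apply: f_inj; exact: (fintype.subsetP (sV s sK)).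
have fE : faces [set f @: s | s : {set 'I_m} in K] = [set f @: s | s : {set 'I_m} in faces K].
  apply/setP => u; rewrite inE; apply/andP/imsetP => [[/imsetP[s sK ->]]|[s sK ->]].
    by rewrite cf// => s3; exists s; rewrite // inE sK.
  move: sK; rewrite inE => /andP[sK s3].
  by rewrite cf// s3 imset_f.
have sub s t : s \in K -> t \in K -> f @: s = f @: t -> s \subset t.
  move=> sK tK st; apply/fintype.subsetP => x xs.
  have : f x \in f @: t by rewrite -st imset_f.
  move=> /imsetP[y yt] /f_inj -> //; last exact: (fintype.subsetP (sV t tK)).
  exact: (fintype.subsetP (sV s sK)).
split; rewrite fE.
  apply: card_in_imset => s t; rewrite !inE => /andP[sK _] /andP[tK _] st.
  by apply/eqP; rewrite finset.eqEsubset !sub.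
apply: leq_trans (leq_imset_card f _); apply/subset_leq_card/fintype.subsetP => y.
move=> /bigcupP[u /imsetP[s]]; rewrite inE => /andP[sK _] -> /imsetP[x xs ->].
by rewrite imset_f// (fintype.subsetP (sV s sK)).
Qed.

Lemma A_subcomplex_sparse (R : realType) (eps : R) n (Y S : {set {set 'I_n}}) M :
  2 * eps^-1 <= M%:R -> A_subcomplex eps Y S ->
  sparse M (faces S) && (faces S \subset Y).
Proof.
move=> epsM [_ SY [m [Z [[mZ fZ _] ZS]]]].
have [[[cZ _] _] _ _] := mZ.
have [fE vE] := isomorphic_faces _ _ _ _ cZ ZS.
rewrite /sparse fE minimal_cycle_faces_gt0//=.
have -> : (#|faces Z| <= M)%N by rewrite -(ler_nat R) (le_trans fZ).
have -> : (2 * #|finset.cover (faces S)| <= #|faces Z| + 4)%N.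
  by rewrite (leq_trans _ (minimal_cycle_vertices _ _ mZ))// leq_mul2l.
rewrite /= andbT; apply/andP; split; apply/fintype.subsetP => t; rewrite !inE => /andP[]//.
by move=> tS _; exact: (fintype.subsetP SY).
Qed.

(** Each such family is the image of a family of subsets of ['I_k] under a map ['I_k -> 'I_n]: there
    are [n ^ k] maps and [2 ^ 2 ^ k] families. *)
Lemma card_small_cover n k :
  (#|[set T : {set {set 'I_n}} | 0 < #|finset.cover T| <= k]| <= n ^ k * 2 ^ 2 ^ k)%N.
Proof.
pose h (u : {ffun 'I_k -> 'I_n} * {set {set 'I_k}}) : {set {set 'I_n}} :=
  [set u.1 @: s | s : {set 'I_k} in u.2].
apply: (@leq_trans #|h @: finset.setT|); last first.
  rewrite (leq_trans (leq_imset_card _ _))// cardsT card_prod card_ffun !card_ord.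
  have cs (X : finType) : #|{set X}| = (2 ^ #|X|)%N by rewrite -!cardsT -card_powerset finset.powersetT.
  by rewrite !cs card_ord.
apply/subset_leq_card/fintype.subsetP => T; rewrite inE => /andP[/card_gt0P[x0 _] Tk].
(* [g] enumerates the cover; [x0] pads the list when the cover has fewer than [k] elements. *)
pose g : {ffun 'I_k -> 'I_n} := [ffun i : 'I_k => nth x0 (enum (finset.cover T)) i].
have gT x : x \in finset.cover T -> exists i, g i = x.
  move=> xT; have xi : (index x (enum (finset.cover T)) < k)%N.
    by rewrite (leq_trans _ Tk)// cardE index_mem mem_enum.
  by exists (Ordinal xi); rewrite ffunE/= nth_index// mem_enum.
apply/imsetP; exists (g, [set s : {set 'I_k} | g @: s \in T]) => //.
apply/setP => t; apply/idP/imsetP => /= [tT|[s + ->]]; last by rewrite inE.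
exists (g @^-1: t); rewrite ?inE.
all: have -> : g @: (g @^-1: t) = t.
1,3: apply/setP => x; apply/imsetP/idP => [[i + ->]|xt]; first by rewrite inE.
1,2: have [|i gi] := gT x; first by apply/bigcupP; exists t.
1,2: by exists i; rewrite ?inE gi.
all: by [].
Qed.

(** * Betti numbers, face counts and face removal *)

Lemma betti2_le_faces n (K : {set {set 'I_n}}) : (betti K 2 <= #|faces K|)%N.
Proof. by rewrite (leq_trans (leq_subr _ _))// rank_leq_row. Qed.

(** Rank-nullity: the rank of [boundary K 2] is at most the number of edges. *)
Lemma faces_le_betti2 n (K : {set {set 'I_n}}) :
  (forall s, s \in K -> #|s| <= 3)%N -> (#|faces K| <= betti K 2 + 'C(n, 2))%N.
Proof.
move=> K3; rewrite betti2E// mxrank_ker -leq_subLR subKn ?rank_leq_row//.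
rewrite (leq_trans (rank_leq_col _))//.
rewrite -[n in 'C(n, _)]card_ord -cardsT -cards_draws; apply/subset_leq_card.
by apply/fintype.subsetP => t; rewrite !inE finset.subsetT => /andP[_].
Qed.

Lemma face_removal_sub (R : realType) (eps : R) n (Y Y' : {set {set 'I_n}}) :
  face_removal eps Y Y' -> Y' \subset Y.
Proof.
by move=> [sel [_ selE]]; apply/fintype.subsetP => t /selE[].
Qed.

(** Whatever the selection, every removed face lies in the union of the sparse face sets contained
    in [Y], each of which has at most [M] elements. *)
Lemma face_removal_card (R : realType) (eps : R) n (Y Y' : {set {set 'I_n}}) M :
  2 * eps^-1 <= M%:R -> face_removal eps Y Y' ->
  (#|faces Y| <= #|faces Y'| + M * #|[set T | sparse M T & T \subset Y]|)%N.
Proof.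
move=> epsM [sel [selP selE]].
set B := [set T | _].
have sub : faces Y \subset faces Y' :|: finset.cover B.
  apply/fintype.subsetP => t; rewrite !inE => /andP[tY ->]; rewrite andbT.
  have [//|tY'] := boolP (t \in Y'); rewrite /=.
  have [[S SA St]|nex] := pselect (exists2 S, A_subcomplex eps Y S & sel S = t).
    apply/bigcupP; exists (faces S); last by rewrite -St; case: (selP S SA).
    by rewrite inE; exact: A_subcomplex_sparse SA.
  by move/negP: tY'; case; apply/selE.
apply: (leq_trans (subset_leq_card sub)).
apply: (leq_trans (leq_card_setU _ _)); rewrite leq_add2l.
apply: (leq_trans (leq_card_cover _)); rewrite mulnC -sum_nat_const.
apply: leq_sum => T; rewrite inE => /andP[/and3P[_ /andP[_ ->]]].
by [].
Qed.

(** * The law of the random complex *)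

(** [Y] takes finitely many values, so probabilities become finite sums of the weights of single
    complexes; the moment estimates are carried out on these sums. *)
Lemma random_complex_law (R : realType) (d : measure_display)
    (Omega : measurableType d) (P : probability Omega R) n
    (Y : Omega -> {set {set 'I_n}}) (Q : {set {set 'I_n}} -> bool) :
  random_complex Y ->
  P [set w | Q (Y w)]%classic =
  (\sum_(K | Q K) fine (P [set w | Y w = K]%classic))%:E.
Proof.
move=> Ym.
have -> : [set w | Q (Y w)]%classic =
    (\bigcup_(K in [set K | Q K]) [set w | Y w = K])%classic.
  by apply/seteqP; split => [w /= QY|w [K /= QK ->]//]; exists (Y w).
rewrite (_ : [set K | Q K]%classic = [set` enum Q]%classic); last first.
  by apply/seteqP; split => K /=; rewrite mem_enum.
rewrite measure_fin_bigcup//; last by move=> K L _ _ [w [/= <- <-]].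
rewrite -fsbig_seq ?enum_uniq// big_enum/= -sumEFin.
by apply: eq_bigr => K _; rewrite fineK// fin_num_measure.
Qed.

Lemma random_complex_measurable (d : measure_display)
    (Omega : measurableType d) n (Y : Omega -> {set {set 'I_n}})
    (Q : {set {set 'I_n}} -> Prop) :
  random_complex Y -> measurable [set w | Q (Y w)]%classic.
Proof.
move=> Ym.
have -> : [set w | Q (Y w)]%classic =
    (\bigcup_(K in [set K | Q K]) [set w | Y w = K])%classic.
  by apply/seteqP; split => [w /= QY|w [K /= QK ->]//]; exists (Y w).
exact: fin_bigcup_measurable.
Qed.

Lemma markov_finite (R : realType) (I : finType) (q X : I -> R) (a : R) :
  (forall i, 0 <= q i) -> (forall i, 0 <= X i) -> 0 < a ->
  \sum_(i | a <= X i) q i <= (\sum_i q i * X i) / a.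
Proof.
move=> q0 X0 a0; rewrite ler_pdivlMr// big_distrl/= [leLHS]big_mkcond/=.
apply: ler_sum => i _; case: ifPn => [aX|_]; last exact: mulr_ge0.
exact: ler_wpM2l.
Qed.

Lemma sum_count (R : realType) n (q : {set {set 'I_n}} -> R)
    (C : {set {set {set 'I_n}}}) :
  \sum_K q K * (#|[set T in C | T \subset K]|%:R) =
  \sum_(T in C) \sum_(K : {set {set 'I_n}} | T \subset K) q K.
Proof.
under [RHS]eq_bigr do rewrite big_mkcond.
rewrite [RHS]exchange_big /=; apply: eq_bigr => K _.
rewrite -sum1dep_card natr_sum big_distrr /= big_mkcondr /=.
by apply: eq_bigr => T _; rewrite mulr1.
Qed.

(** * Moment estimates for a law on finite complexes *)

Section law.
Variables (R : realType) (n : nat) (p : R) (q : {set {set 'I_n}} -> R).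
Hypothesis q_ge0 : forall K, 0 <= q K.
Hypothesis q_sum1 : \sum_K q K = 1.
(** [q K] stands for the probability of [Y = K]; the independence of the triangles enters through
    this identity. *)
Hypothesis q_sub : forall T : {set {set 'I_n}}, T \subset triangles n ->
  \sum_(K : {set {set 'I_n}} | T \subset K) q K = p ^+ #|T|.

Let F (K : {set {set 'I_n}}) : R := #|faces K|%:R.
Let N : R := #|triangles n|%:R.

Lemma faces_sum K : F K = \sum_(t in triangles n) (t \in K)%:R.
Proof.
rewrite /F -sum1_card natr_sum -natr_sum sum1_card.
rewrite (_ : faces K = [set t in triangles n | t \in K]); last first.
  by apply/setP => t; rewrite !inE andbC.
rewrite -sum1dep_card natr_sum big_mkcondr /=.
by apply: eq_bigr => t _; case: (t \in K).
Qed.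

Lemma expected_faces : \sum_K q K * F K = N * p.
Proof.
under eq_bigr do rewrite faces_sum big_distrr /=.
rewrite exchange_big /= /N -sum1_card natr_sum big_distrl /=.
apply: eq_bigr => t tT; rewrite mul1r -[p]expr1 -(cards1 t) -q_sub; last first.
  by rewrite finset.sub1set.
rewrite [RHS]big_mkcond /=; apply: eq_bigr => K _.
by rewrite finset.sub1set; case: (t \in K); rewrite ?mulr1 ?mulr0.
Qed.

(** The square expands into ordered pairs of triangles, contributing [p] on the diagonal and
    [p ^+ 2] off it. Adding the missing diagonal terms [p ^+ 2] gives the bound. *)
Lemma expected_faces_sqr : \sum_K q K * F K ^+ 2 <= N * p + (N * p) ^+ 2.
Proof.
have -> : \sum_K q K * F K ^+ 2 =
    \sum_(s in triangles n) \sum_(t in triangles n) p ^+ #|[set s; t]|.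
  under eq_bigr do rewrite faces_sum expr2 big_distrl big_distrr /=.
  rewrite exchange_big /=; apply: eq_bigr => s sT.
  under eq_bigr do rewrite !big_distrr /=.
  rewrite exchange_big /=; apply: eq_bigr => t tT.
  rewrite -q_sub ?finset.subUset ?finset.sub1set ?sT//.
  rewrite [RHS]big_mkcond /=; apply: eq_bigr => K _.
  rewrite finset.subUset !finset.sub1set.
  by case: (s \in K); case: (t \in K); rewrite ?mulr1 ?mulr0.
have -> : N * p + (N * p) ^+ 2 =
    \sum_(s in triangles n) (p + \sum_(t in triangles n) p ^+ 2).
  have cE (a : R) : \sum_(t in triangles n) a = N * a by rewrite sumr_const -mulr_natl.
  by rewrite !cE; ring.
apply: ler_sum => s sT; rewrite (bigD1 s)//=.
have -> : #|[set s; s]| = 1%N by rewrite finset.setUid cards1.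
rewrite expr1 lerD2l [leRHS](bigD1 s)//=.
rewrite -[leLHS]add0r lerD ?sqr_ge0//.
by apply: ler_sum => t /andP[_ ts]; rewrite cards2 eq_sym ts.
Qed.

Lemma chebyshev_faces (dl : R) : 0 < dl -> 0 < N * p ->
  \sum_(K | dl * (N * p) <= `|F K - N * p|) q K <= (dl ^+ 2 * (N * p))^-1.
Proof.
move=> dl0 Np0.
have -> : \sum_(K | dl * (N * p) <= `|F K - N * p|) q K =
    \sum_(K | (dl * (N * p)) ^+ 2 <= (F K - N * p) ^+ 2) q K.
  apply: eq_bigl => K.
  by rewrite -(real_normK (num_real (F K - _))) ler_sqr// nnegrE ltW// mulr_gt0.
apply: le_trans (markov_finite _ _ _ _ _ _ _ _) _ => //.
- by move=> K; exact: sqr_ge0.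
- by rewrite exprn_gt0// mulr_gt0.
(* The variance is at most the mean. *)
have VE : \sum_K q K * (F K - N * p) ^+ 2 <= N * p.
  have -> : \sum_K q K * (F K - N * p) ^+ 2 =
     \sum_K q K * F K ^+ 2 - 2 * (N * p) * (\sum_K q K * F K) + (N * p) ^+ 2 * \sum_K q K.
    rewrite !big_distrr /= -sumrB -big_split /=; apply: eq_bigr => K _; ring.
  rewrite expected_faces q_sum1; have := expected_faces_sqr; nra.
move: (N * p) Np0 VE => m m0 VE.
rewrite ler_pdivrMr ?exprn_gt0 ?mulr_gt0//.
rewrite (_ : _ * _ ^+ 2 = m)//.
by field; rewrite !gt_eqF.
Qed.

(* Here x = n^(1/2) and y = n^(-eps). *)
Lemma expected_sparse M (x y : R) : n%:R = x ^+ 2 -> 1 <= x -> 0 <= p ->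
  x * p <= y -> y <= 1 ->
  \sum_K q K * #|[set T | sparse M T & T \subset K]|%:R <=
  (M.+1 * 2 ^ 2 ^ (M + 4))%:R * (x ^+ 4 * y).
Proof.
move=> nx x1 p0 xpy y1.
have y0 : 0 <= y by apply: le_trans xpy; rewrite mulr_ge0// (le_trans _ x1).
have -> : \sum_K q K * #|[set T | sparse M T & T \subset K]|%:R =
    \sum_(T : {set {set 'I_n}} | sparse M T) p ^+ #|T|.
  have := sum_count R n q [set T | sparse M T].
  under eq_bigr => K _ do [rewrite (_ : [set T in _ | _] =
     [set T | sparse M T & T \subset K]); last by apply/setP => T; rewrite !inE].
  move=> ->; apply: eq_big => T; rewrite inE// => /and3P[TT _ _].
  exact: q_sub.
(* The sparse sets are grouped by their number [f] of triangles; the [M.+1] classes account for the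
   factor [M.+1]. *)
rewrite (partition_big (fun T : {set {set 'I_n}} => inord #|T| : 'I_M.+1) xpredT)//=.
rewrite mulnC natrM -mulrA mulrCA -[X in X%:R * _]card_ord mulr_natl -sumr_const.
apply: ler_sum => f _.
rewrite (eq_bigr (fun=> p ^+ f)); last first.
  by move=> T /andP[/and3P[_ /andP[_ TM] _] /eqP <-]; rewrite inordK.
have [f0|f0] := eqVneq (f : nat) 0%N.
  rewrite big_pred0 ?mulr_ge0 ?exprn_ge0 ?(le_trans _ x1)// => T.
  apply/negP => /andP[/and3P[_ /andP[T0 TM] _] /eqP/(congr1 val)/=].
  by rewrite inordK// f0 => TE; rewrite TE in T0.
(* By sparseness a set of [f] triangles covers at most [k] vertices, and [n ^ k <= x ^ (f + 4)]. *)
pose k := ((f + 4)./2)%N.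
rewrite sumr_const -[leLHS]mulr_natl.
apply: (@le_trans _ _ ((n ^ k * 2 ^ 2 ^ k)%:R * p ^+ f)).
  rewrite ler_wpM2r ?exprn_ge0// ler_nat (leq_trans _ (card_small_cover n k))//.
  apply/subset_leq_card/fintype.subsetP => T.
  rewrite !inE /sparse.
  move=> /andP[/and3P[/fintype.subsetP TT /andP[/card_gt0P[t tT] TM] Tk]].
  move=> /eqP/(congr1 val)/=.
  rewrite inordK// => fE; apply/andP; split; last by rewrite /k geq_half_double -mul2n -fE.
  have : (0 < #|t|)%N by have := TT _ tT; rewrite inE => /eqP ->.
  move=> /card_gt0P[i it]; apply/card_gt0P; exists i.
  by apply/bigcupP; exists t.
rewrite mulnC natrM -mulrA; apply: ler_pM => //.
- by rewrite mulr_ge0 ?exprn_ge0.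
- rewrite ler_nat !leq_exp2l// /k; have := ltn_ord f; lia.
rewrite natrX nx -exprM.
have x0 : 0 <= x by rewrite (le_trans _ x1).
apply: (@le_trans _ _ (x ^+ (f + 4) * p ^+ f)).
  rewrite ler_wpM2r ?exprn_ge0// ler_weXn2l// /k; lia.
rewrite addnC exprD -mulrA ler_wpM2l ?exprn_ge0// -exprMn.
(* Since [f > 0] and [x * p <= y <= 1], the power [(x * p) ^+ f] is at most [y]. *)
case: (nat_of_ord f) f0 => [//|g _].
rewrite exprS -[leRHS]mulr1; apply: ler_pM => //.
- by rewrite mulr_ge0.
- by rewrite exprn_ge0 ?mulr_ge0.
- by rewrite exprn_ile1 ?mulr_ge0// (le_trans xpy).
Qed.

(** Union bound: the face count fails by Chebyshev's inequality, the count of sparse sets by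
    Markov's, where [n ^ 2 = x ^ 4] cancels. *)
Lemma typical_complex M (x y dl et : R) : n%:R = x ^+ 2 -> 1 <= x -> 0 <= p ->
  x * p <= y -> y <= 1 -> 0 < dl -> 0 < et -> 0 < N * p ->
  1 - (dl ^+ 2 * (N * p))^-1 - (M.+1 * 2 ^ 2 ^ (M + 4))%:R * y / et <=
  \sum_(K | (`|F K - N * p| < dl * (N * p)) &&
            (#|[set T | sparse M T & T \subset K]|%:R < et * n%:R ^+ 2)) q K.
Proof.
move=> nx x1 p0 xpy y1 dl0 et0 Np0.
pose A K := `|F K - N * p| < dl * (N * p).
pose B (K : {set {set 'I_n}}) :=
  #|[set T | sparse M T & T \subset K]|%:R < et * n%:R ^+ 2.
have := q_sum1; rewrite (bigID (fun K => A K && B K) xpredT) /= => q1.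
rewrite -[leRHS](addrK (\sum_(K | ~~ (A K && B K)) q K)) q1 -addrA -opprD lerD2l lerN2.
apply: (@le_trans _ _ (\sum_(K | ~~ A K) q K + \sum_(K | ~~ B K) q K)).
  rewrite big_mkcond [X in _ <= X + _]big_mkcond [X in _ <= _ + X]big_mkcond.
  rewrite -big_split /=; apply: ler_sum => K _; have := q_ge0 K.
  by case: (A K); case: (B K) => /= qK; rewrite ?addr0 ?add0r ?lerDl.
apply: lerD.
  under eq_bigl do rewrite /A -leNgt.
  exact: chebyshev_faces.
under eq_bigl do rewrite /B -leNgt.
have n0 : 0 < (n%:R : R) by rewrite nx exprn_gt0// (lt_le_trans _ x1).
apply: le_trans (markov_finite _ _ _ _ _ _ _ _) _ => //.
  by rewrite mulr_gt0 ?exprn_gt0.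
have := expected_sparse M x y nx x1 p0 xpy y1.
rewrite ler_pdivrMr ?mulr_gt0 ?exprn_gt0//; move/le_trans; apply.
rewrite nx -exprM le_eqVlt; apply/orP; left; apply/eqP.
by field; rewrite gt_eqF.
Qed.
End law.

(** * Asymptotics *)

Lemma linial_meshulam_sub (R : realType) (d : measure_display)
    (Omega : measurableType d) (P : probability Omega R) n (p : R)
    (Y : Omega -> {set {set 'I_n}}) (T : {set {set 'I_n}}) :
  linial_meshulam P p Y -> T \subset triangles n ->
  \sum_(K : {set {set 'I_n}} | T \subset K) fine (P [set w | Y w = K]%classic) =
  p ^+ #|T|.
Proof.
move=> [Ym _ _ Pp Pi] TT; apply: EFin_inj.
rewrite -(random_complex_law _ _ _ _ _ _ (fun K => T \subset K) Ym).
have -> : [set w | T \subset Y w]%classic =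
    [set w | forall t, t \in T -> [set w | t \in Y w]%classic w]%classic.
  by apply/seteqP; split => w /=; [move=> /fintype.subsetP|move=> TY; apply/fintype.subsetP].
rewrite Pi// (eq_bigr (fun=> p%:E)); last first.
  by move=> t tT; rewrite Pp//; exact: (fintype.subsetP TT).
by rewrite -(big_morph EFin (@EFinM R) erefl) prodr_const.
Qed.

Lemma bin2_natr (R : realType) n : 'C(n, 2)%:R = n%:R * (n%:R - 1) / 2 :> R.
Proof.
elim: n => [|n IHn]; first by rewrite bin0n !mul0r.
by rewrite binS natrD IHn bin1 -natr1; field.
Qed.

Lemma card_triangles (R : realType) n :
  #|triangles n|%:R = n%:R * (n%:R - 1) * (n%:R - 2) / 6 :> R.
Proof.
rewrite /triangles (_ : [set t | _] = [set t : {set 'I_n} | t \subset finset.setT & #|t| == 3%N]); last first.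
  by apply/setP => t; rewrite !inE finset.subsetT.
rewrite cards_draws cardsT card_ord.
elim: n => [|n IHn]; first by rewrite bin0n !mul0r.
rewrite binS natrD IHn.
by rewrite bin2_natr -natr1; field.
Qed.

(** Here [x] is the number of vertices. The choice of [dl] makes [dl * c = (c - 3) / 16], so the
    leading coefficient [(1 - dl) * c / 6] equals [1 / 2 + (c - 3) * 15 / 96]. Of this,
    [(c - 3) * 2 / 96] is spent on lower-order terms. *)
Lemma triangle_surplus (R : realFieldType) (c x p Np F : R) :
  let dl := (c - 3) / (16 * c) in
  3 < c -> 24 * c <= (c - 3) * x -> c < x * p ->
  Np = x * (x - 1) * (x - 2) / 6 * p -> Np - dl * Np < F ->
  x ^+ 2 / 2 + (c - 3) * (13 / 96) * x ^+ 2 <= F.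
Proof.
move=> dl c3 cx xp NpE /ltW; apply: le_trans.
have x24 : 24 < x by nra.
have dlc : dl * c = (c - 3) / 16 by rewrite /dl; field; lra.
have dl1 : dl <= 1 by rewrite /dl ler_pdivrMr; lra.
pose z := (x - 1) * (x - 2) / 6.
have z0 : 0 <= z by rewrite /z; clear -x24; nra.
have Npc : c * z <= Np.
  rewrite NpE (_ : _ * p = x * p * z); first exact: ler_wpM2r z0 _ _ (ltW xp).
  by rewrite /z; field.
have : (1 - dl) * (c * z) <= (1 - dl) * Np by rewrite ler_wpM2l// subr_ge0.
rewrite -[X in _ -> _ <= X - _]mul1r -mulrBl; apply: le_trans.
rewrite (_ : (1 - dl) * (c * z) = (c - (c - 3) / 16) * z); last by rewrite -dlc; ring.
rewrite /z {Npc z0 z dl1 dlc dl NpE xp F Np p}.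
(* Replacing [(x - 1) * (x - 2)] by [x ^+ 2] costs at most [c * x / 2], which is at most
   [(c - 3) * x ^+ 2 / 48] by this inequality. *)
have cx2 : 0 <= ((c - 3) * x - 24 * c) * x by rewrite mulr_ge0 ?subr_ge0//; lra.
nra.
Qed.

(** The deterministic part. Of the surplus [(c - 3) * 13 / 96] over [n ^ 2 / 2], removal costs at
    most [(c - 3) / 96], which leaves [(c - 3) / 8]; the edges are paid for by [n ^ 2 / 2]. *)
Lemma betti2_face_removal (R : realType) (c eps p : R) n M
    (Y Y' : {set {set 'I_n}}) : let Np := #|triangles n|%:R * p in
  3 < c -> c / n%:R < p -> p < n%:R `^ (- (1 / 2) - eps) ->
  24 * c <= (c - 3) * n%:R -> 2 * eps^-1 <= M%:R ->
  is_2complex Y -> face_removal eps Y Y' ->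
  `|#|faces Y|%:R - Np| < (c - 3) / (16 * c) * Np ->
  #|[set T | sparse M T & T \subset Y]|%:R < (c - 3) / (96 * M.+1%:R) * n%:R ^+ 2 ->
  n%:R ^+ 2 * ((c - 3) / 8) <= (betti Y' 2)%:R /\
  (betti Y' 2)%:R <= n%:R `^ (5 / 2 - eps).
Proof.
move=> Np c3 cp pn cn epsM [_ Y3] rem FY BY.
have n24 : 24 < (n%:R : R) by clear -c3 cn; nra.
have n0 : 0 < (n%:R : R) by rewrite (lt_trans _ n24).
have c0 : 0 < c by rewrite (lt_trans _ c3).
have p0 : 0 < p by apply: lt_trans cp; rewrite divr_gt0.
have YY' := face_removal_sub _ _ _ _ _ rem.
have NpE : Np = n%:R * (n%:R - 1) * (n%:R - 2) / 6 * p by rewrite /Np card_triangles.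
move: FY; rewrite ltr_distl => /andP[F1 F2].
split.
  have Y'3 s : s \in Y' -> (#|s| <= 3)%N by move=> /(fintype.subsetP YY')/Y3.
  have := face_removal_card _ _ _ _ _ _ epsM rem.
  rewrite -(ler_nat R) natrD natrM.
  have := faces_le_betti2 _ _ Y'3; rewrite -(ler_nat R) natrD bin2_natr.
  have : M%:R * #|[set T | sparse M T & T \subset Y]|%:R <= (c - 3) / 96 * n%:R ^+ 2 :> R.
    apply: (@le_trans _ _ (M.+1%:R * ((c - 3) / (96 * M.+1%:R) * n%:R ^+ 2))).
      by apply: ler_pM; rewrite // ?ler_nat// ltW.
    have : (M.+1%:R : R) != 0 by rewrite pnatr_eq0.
    move: (M.+1%:R : R) => m m0.
    by rewrite (_ : m * _ = (c - 3) / 96 * n%:R ^+ 2)//; field.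
  have : c < n%:R * p by rewrite mulrC -ltr_pdivrMr.
  move=> /(triangle_surplus _ _ _ _ _ _ c3 cn)/(_ NpE F1).
  by clear -n0; lra.
(* For the upper bound, the number of faces of [Y] is at most [2 * Np <= n ^ 3 * p]. *)
have pE : n%:R ^+ 3 * n%:R `^ (- (1 / 2) - eps) = n%:R `^ (5 / 2 - eps).
  rewrite -powR_mulrn// -powRD; last by apply/implyP => _; rewrite gt_eqF.
  by congr (_ `^ _); clear; lra.
rewrite -pE; apply: (@le_trans _ _ (n%:R ^+ 3 * p)); last first.
  by rewrite ler_wpM2l ?exprn_ge0// ltW.
have dl1 : (c - 3) / (16 * c) <= 1 by clear -c3 c0; rewrite ler_pdivrMr; lra.
have Np0 : 0 <= Np by rewrite /Np mulr_ge0// ltW.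
have Np3 : 2 * Np <= n%:R ^+ 3 * p.
  by rewrite NpE mulrA ler_wpM2r ?(ltW p0)//; clear -n24; nra.
have dlN : (c - 3) / (16 * c) * Np <= Np by rewrite -[leRHS]mul1r ler_wpM2r.
have bF' : (betti Y' 2)%:R <= #|faces Y'|%:R :> R by rewrite ler_nat betti2_le_faces.
have F'F : #|faces Y'|%:R <= #|faces Y|%:R :> R.
  rewrite ler_nat; apply/subset_leq_card/fintype.subsetP => t; rewrite !inE.
  by move=> /andP[/(fintype.subsetP YY') ->].
apply: (le_trans bF'); apply: (le_trans F'F); apply: (le_trans (ltW F2)).
by apply: le_trans Np3; rewrite [leRHS]mulr_natl [leRHS]mulr2n lerD2l.
Qed.

Local Open Scope classical_set_scope.

Lemma nearby_powRN_lt (R : realType) (a e : R) : 0 < a -> 0 < e ->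
  \forall n \near \oo, n%:R `^ (- a) < e.
Proof.
move=> a0 e0; near=> n.
have n_gt : (e^-1) `^ (a^-1) < n%:R by near: n; exact: nbhs_infty_gtr.
rewrite powRN invf_plt ?posrE//; last first.
  by rewrite powR_gt0// (le_lt_trans _ n_gt)// powR_ge0.
have -> : e^-1 = ((e^-1) `^ (a^-1)) `^ a.
  by rewrite -powRrM mulVf ?gt_eqF// powRr1// invr_ge0 ltW.
by apply: gt0_ltr_powR => //; rewrite ?in_itv/= ?nnegrE ?powR_ge0 ?ler0n.
Unshelve. all: by end_near. Qed.

Theorem proposition5p11 (R : realType) (c eps : R) (p : nat -> R)
  (d : nat -> measure_display)
  (Omega : forall n : nat, measurableType (d n))
  (P : forall n : nat, probability (Omega n) R)
  (Y Y' : forall n : nat, Omega n -> {set {set 'I_n}})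
  (hc : 3 < c) (heps : 0 < eps)
  (hp : \forall n \near \oo,
     c / n%:R < p n /\ p n < n%:R `^ (- (1 / 2) - eps))
  (hY : forall n : nat, linial_meshulam (P n) (p n) (Y n))
  (hY'meas : forall n : nat, random_complex (Y' n))
  (hY' : forall (n : nat) (w : Omega n), face_removal eps (Y n w) (Y' n w)) :
  P n [set w : Omega n |
        n%:R ^+ 2 * ((c - 3) / 8) <= ((betti (Y' n w) 2)%:R : R) /\
        ((betti (Y' n w) 2)%:R : R) <= n%:R `^ (5 / 2 - eps)]
    @[n --> \oo] --> 1%E.
Proof.
pose M := Num.bound (2 * eps^-1).
have epsM : 2 * eps^-1 <= M%:R.
  by apply/ltW/archi_boundP; rewrite mulr_ge0// invr_ge0 ltW.
pose dl := (c - 3) / (16 * c); pose et := (c - 3) / (96 * M.+1%:R).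
have c0 : 0 < c by rewrite (lt_trans _ hc).
have dl0 : 0 < dl by rewrite divr_gt0 ?mulr_gt0 ?subr_gt0.
have et0 : 0 < et by rewrite divr_gt0 ?mulr_gt0 ?subr_gt0.
(* The constant in the Markov term of [typical_complex]. *)
pose D : R := (M.+1 * 2 ^ 2 ^ (M + 4))%:R.
have D0 : 0 <= D by [].
have D1 : 0 < D + 1 by rewrite ltr_wpDl.
pose bnd n (K : {set {set 'I_n}}) := n%:R ^+ 2 * ((c - 3) / 8) <= ((betti K 2)%:R : R) /\
  ((betti K 2)%:R : R) <= n%:R `^ (5 / 2 - eps).
pose S n := [set w : Omega n | bnd n (Y' n w)].
change (P n (S n) @[n --> \oo] --> 1%E).
have Sm n : measurable (S n).
  exact: (random_complex_measurable _ _ _ _ (bnd n) (hY'meas n)).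
apply/fine_cvgP; split; first by near=> n; exact: fin_num_measure.
apply/cvgrPdist_lt => e e0; near=> n.
have [cp pn] : c / n%:R < p n /\ p n < n%:R `^ (- (1 / 2) - eps) by near: n.
have cn : 24 * c <= (c - 3) * n%:R.
  rewrite [leRHS]mulrC -ler_pdivrMr ?subr_gt0//.
  by near: n; exact: nbhs_infty_ger.
have n24 : 24 < (n%:R : R) by clear -hc cn; nra.
(* This threshold and the next one make the Chebyshev and the Markov error each smaller than
   [e / 2]. Dividing by [D + 1] keeps the denominator positive. *)
have ne : 2 / (dl ^+ 2 * e) < n%:R by near: n; exact: nbhs_infty_gtr.
have ye : n%:R `^ (- eps) < et * e / (2 * (D + 1)).
  near: n; apply: nearby_powRN_lt => //.
  exact: divr_gt0 (mulr_gt0 et0 e0) (mulr_gt0 (ltr0Sn _ 1) D1).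
have n0 : 0 < (n%:R : R) by rewrite (lt_trans _ n24).
have n1 : 1 <= (n%:R : R) by clear -n24; lra.
have p0 : 0 < p n by apply: lt_trans cp; rewrite divr_gt0// (lt_trans _ hc).
pose x : R := n%:R `^ (1 / 2); pose y : R := n%:R `^ (- eps).
have nx : n%:R = x ^+ 2.
  rewrite -powR_mulrn ?powR_ge0// -powRrM (_ : 1 / 2 * 2 = 1); last by field.
  by rewrite powRr1// ltW.
have x1 : 1 <= x by rewrite -(powRr0 n%:R) ler_powR// divr_ge0.
have y1 : y <= 1 by rewrite -(powRr0 n%:R) ler_powR// oppr_le0 ltW.
have xpy : x * p n <= y.
  apply: (@le_trans _ _ (x * n%:R `^ (- (1 / 2) - eps))).
    by rewrite ler_wpM2l ?powR_ge0// ltW.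
  rewrite -powRD; last by apply/implyP => _; rewrite gt_eqF.
  by rewrite addrA subrr add0r.
(* A crude lower bound on the expected number of faces, from [n * p > 3] and
   [(n - 1) * (n - 2) >= 2 * n]; it makes the Chebyshev error tend to 0. *)
have nN : n%:R <= #|triangles n|%:R * p n.
  rewrite card_triangles.
  have cpn : c < n%:R * p n by rewrite mulrC -ltr_pdivrMr.
  rewrite (_ : _ * p n = n%:R * p n * ((n%:R - 1) * (n%:R - 2) / 6)); last by field.
  apply: (@le_trans _ _ (3 * ((n%:R - 1) * (n%:R - 2) / 6))); first by clear -n24; nra.
  apply: ler_wpM2r; last by rewrite ltW// (lt_trans hc).
  by clear -n24; nra.
have [Ym Y2 _ _ _] := hY n.
pose G (K : {set {set 'I_n}}) : bool :=
  (`|#|faces K|%:R - #|triangles n|%:R * p n| < dl * (#|triangles n|%:R * p n)) &&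
  (#|[set T | sparse M T & T \subset K]%SET|%:R < et * n%:R ^+ 2).
pose q K := fine (P n [set w | Y n w = K]).
have q0 K : 0 <= q K by rewrite fine_ge0.
have q1 : \sum_K q K = 1.
  have := random_complex_law _ _ _ (P n) _ _ xpredT Ym.
  rewrite (_ : [set w | _] = setT); last by apply/seteqP.
  by rewrite probability_setT => -[].
have := typical_complex _ n (p n) q q0 q1
  (fun T => linial_meshulam_sub _ _ _ _ _ _ _ T (hY n)) M x y dl et nx x1 (ltW p0)
  xpy y1 dl0 et0 (lt_le_trans n0 nN).
rewrite -/D -lee_fin -(random_complex_law _ _ _ (P n) _ _ _ Ym) => PS.
(* The event that [Y] is typical is contained in [S n]. *)
have {}PS : ((1 - (dl ^+ 2 * (#|triangles n|%:R * p n))^-1 - D * y / et)%:E <= P n (S n))%E.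
  apply: (le_trans PS); apply: le_measure; rewrite ?inE//.
    exact: (random_complex_measurable _ _ _ _ (fun K => G K) Ym).
  move=> w /= /andP[FY BY].
  by apply: (betti2_face_removal _ c eps (p n) n M (Y n w)).
have PS1 : (P n (S n) <= 1)%E by exact: probability_le1.
have Pf : P n (S n) = (fine (P n (S n)))%:E by rewrite fineK// fin_num_measure.
rewrite Pf !lee_fin in PS PS1.
rewrite ger0_norm ?subr_ge0//.
have e1 : (dl ^+ 2 * (#|triangles n|%:R * p n))^-1 < e / 2.
  have dN0 := mulr_gt0 (exprn_gt0 2 dl0) (lt_le_trans n0 nN).
  rewrite invf_plt ?posrE//; last exact: divr_gt0.
  apply: (@lt_le_trans _ _ (dl ^+ 2 * n%:R)); last by rewrite ler_wpM2l ?sqr_ge0.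
  rewrite [ltRHS]mulrC -ltr_pdivrMr; last exact: exprn_gt0.
  by rewrite invf_div -mulrA -invfM [e * _]mulrC.
have e2 : D * y / et < e / 2.
  rewrite ltr_pdivrMr//.
  apply: (@le_lt_trans _ _ (D * (et * e / (2 * (D + 1))))).
    by rewrite ler_wpM2l// ltW.
  have De : 0 < et * e by rewrite mulr_gt0.
  move: (D) D0 De => D' D'0 De.
  rewrite mulrA ltr_pdivrMr; last by rewrite mulr_gt0// ltr_wpDl.
  by clear -D'0 De; nra.
rewrite /=; move: PS e1 e2; move: (_^-1) (_ * y / et) (fine _) => u v w; clear; lra.
Unshelve. all: by end_near. Qed.
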